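(* Let $\mathcal{R}$ be a Rickart $\ast$-ring. The plus relation $\leq^{+}$ is a partial order on $\mathcal{R}$.
   Context: A $\ast$-ring is an associative ring with an involution $\ast$, i.e. $(x^{\ast})^{\ast}=x$, $(x+y)^{\ast}=x^{\ast}+y^{\ast}$, $(xy)^{\ast}=y^{\ast}x^{\ast}$. For $a\in\mathcal{R}$, $a^{\circ}=\{x\in\mathcal{R}: ax=0\}$ and ${}^{\circ}a=\{x\in\mathcal{R}: xa=0\}$. A Rickart $\ast$-ring is a $\ast$-ring $\mathcal{R}$ in which for every $a\in\mathcal{R}$ there is a projection $e=e^{2}=e^{\ast}\in\mathcal{R}$ with ${}^{\circ}a=\mathcal{R}e$; such a ring has a multiplicative identity $1$. Put $\mathrm{LP}(a)=\{p\in\mathcal{R}: p=p^{2},\ {}^{\circ}a={}^{\circ}p\}$ and $\mathrm{RP}(a)=\{q\in\mathcal{R}: q=q^{2},\ a^{\circ}=q^{\circ}\}$. For $a,b\in\mathcal{R}$, $a\leq^{+}b$ means that ${}^{\circ}b\subseteq{}^{\circ}a$, $b^{\circ}\subseteq a^{\circ}$, and there exist $q\in\mathrm{RP}(a)$ and $\widetilde{q}\in\mathrm{LP}(a)$ such that $a=\widetilde{q}bq$. *)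

(* Defs.v *)
From HB Require Import structures.
From mathcomp Require Import all_boot all_algebra.
From mathcomp Require Import classical_sets.
From Corelib Require Relation_Definitions.

Set Implicit Arguments.
Unset Strict Implicit.
Unset Printing Implicit Defensive.

Local Open Scope classical_set_scope.
Local Open Scope group_scope.

(* Rings are not assumed to be unital: the multiplication is that of an        *)
(* (arbitrary) semigroup, written in group_scope, whereas addition and zero    *)
(* are those of a zmodType, written in ring_scope.                             *)
HB.mixin Record Zmodule_Semigroup_isStarRing R
    of GRing.Zmodule R & Semigroup R := {
  mulgDl : left_distributive ( *%g : R -> R -> R) +%R;
  mulgDr : right_distributive ( *%g : R -> R -> R) +%R;
  star : R -> R;
  starK : involutive star;
  starD : {morph star : x y / (x + y)%R};
  starM : forall x y : R, star (x * y) = star y * star x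
}.

#[short(type="starRingType")]
HB.structure Definition StarRing :=
  { R of GRing.Zmodule R & Semigroup R & Zmodule_Semigroup_isStarRing R }.

Section StarRingDefs.
Variable R : starRingType.
Implicit Types a b : R.

Definition rann a : set R := [set x | a * x = 0%R].
Definition lann a : set R := [set x | x * a = 0%R].

Definition is_idempotent (e : R) : Prop := e = e * e.
Definition is_projection (e : R) : Prop := e = e * e /\ e = star e.

Definition rickart : Prop :=
  forall a, exists2 e, is_projection e & lann a = [set x * e | x in [set: R]].

Definition LP a : set R := [set p | is_idempotent p /\ lann a = lann p].
Definition RP a : set R := [set q | is_idempotent q /\ rann a = rann q].

Definition plus_le a b : Prop :=
  [/\ lann b `<=` lann a, rann b `<=` rann a &
      exists2 q, RP a q & exists2 q', LP a q' & a = q' * b * q].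

End StarRingDefs.

(* Main.v *)
(* A Rickart *-ring has an identity, so an annihilator inclusion lann p <= lann b
   with p idempotent says exactly that p b = b, and LP(a), RP(a) are nonempty.
   Reflexivity and antisymmetry follow at once.  For transitivity, from
   a = q1' b q1 and b = q2' c q2 one gets a = (q1' q2') c (q2 q1); here
   rann b <= rann a gives q1 q2 = q1, so q2 q1 is an idempotent with the same
   right annihilator as q1, and dually on the left via the involution. *)
Require Import Defs.
From mathcomp Require Import all_boot all_algebra.
From mathcomp Require Import classical_sets.
From Corelib Require Relation_Definitions.

Set Implicit Arguments.
Unset Strict Implicit.
Unset Printing Implicit Defensive.

Import GRing.Theory.

Local Open Scope classical_set_scope.
Local Open Scope group_scope.

Section StarRing.
Variable R : starRingType.
Implicit Types a b c p q x y z : R.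

Lemma mulgBr x y z : x * (y - z)%R = ((x * y)%g - (x * z)%g)%R.
Proof. by apply: (addIr (x * z)); rewrite -mulgDr !subrK. Qed.

Lemma mulgBl x y z : (x - y)%R * z = ((x * z)%g - (y * z)%g)%R.
Proof. by apply: (addIr (y * z)); rewrite -mulgDl !subrK. Qed.

Lemma mul0g x : 0%R * x = 0%R :> R.
Proof. by rewrite -(subrr x) mulgBl !subrr. Qed.

Lemma mulg0 x : x * 0%R = 0%R :> R.
Proof. by rewrite -(subrr x) mulgBr !subrr. Qed.

Lemma star0 : star 0%R = 0%R :> R.
Proof. by apply: (addIr (star 0%R)); rewrite -starD !add0r. Qed.

Lemma star_eq0 x : star x = 0%R -> x = 0%R.
Proof. by move/(congr1 star); rewrite starK star0. Qed.

Lemma star_mul_eq0 x y : (star x * star y = 0%R) <-> (y * x = 0%R).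
Proof. by rewrite -starM; split=> [/star_eq0|->]; rewrite ?star0. Qed.

(** The involution reverses products, hence exchanges the two kinds of annihilator. The right-handed
    facts below are obtained from their left-handed twins through this exchange. *)
Lemma rann_star a : rann a = star @^-1` lann (star a).
Proof. by apply/seteqP; split=> x /star_mul_eq0. Qed.

Lemma lann_star a : lann (star a) = star @^-1` rann a.
Proof.
by apply/seteqP; split=> x; rewrite /lann /rann /= -star_mul_eq0 starK.
Qed.

Lemma subset_lann_star a b :
  rann a `<=` rann b -> lann (star a) `<=` lann (star b).
Proof. by rewrite !lann_star => h x; exact: h. Qed.

Lemma eq_lann_star a b : lann (star a) = lann (star b) <-> rann a = rann b.
Proof. by split=> h; rewrite ?lann_star ?h // !rann_star h. Qed.

Lemma LP_star a q : LP (star a) (star q) <-> RP a q.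
Proof.
rewrite /LP /RP /is_idempotent /=; split=> -[hi /eq_lann_star ha]; split=> //.
  by apply: (can_inj (@starK R)); rewrite starM.
by rewrite -starM -hi.
Qed.

Hypothesis hR : rickart R.

(** The left annihilator of 0 is the whole ring, so its generating projection is a right identity;
    being self-adjoint, it is a left identity too. *)
Lemma rickart_unit : exists u : R, (forall x, x * u = x) /\ forall x, u * x = x.
Proof.
have [u [hu su] hl] := hR 0%R.
have ux x : x * u = x.
  have : lann 0%R x by exact: mulg0.
  by rewrite hl => -[y _ <-]; rewrite -mulgA -hu.
exists u; split=> // x.
by apply: (can_inj (@starK R)); rewrite starM -su ux.
Qed.

Lemma idempotent_mull p b : is_idempotent p -> lann p `<=` lann b -> p * b = b.
Proof.
move=> hp hpb; have [u [_ ux]] := rickart_unit.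
(* Since p is idempotent, 1 - p kills p from the left, hence also kills b. *)
have /hpb : lann p (u - p)%R by rewrite /lann /= mulgBl ux -hp subrr.
by rewrite /lann /= mulgBl ux => /subr0_eq.
Qed.

Lemma idempotent_mulr q b : is_idempotent q -> rann q `<=` rann b -> b * q = b.
Proof.
move=> hq hqb; apply: (can_inj (@starK R)); rewrite starM.
apply: idempotent_mull; last exact: subset_lann_star.
by rewrite /is_idempotent -starM -hq.
Qed.

Lemma LP_exists a : exists p, LP a p.
Proof.
have [u [xu ux]] := rickart_unit; have [e [he _] hl] := hR a.
(* The complementary idempotent works: x (1 - e) = 0 exactly when x = x e, that is, when x lies in R
   e = [lann a]. *)
exists (u - e)%R; split.
  by rewrite /is_idempotent mulgBr !mulgBl !ux xu -he subrr subr0.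
rewrite hl; apply/seteqP; split=> x.
  by move=> [y _ <-]; rewrite /lann /= mulgBr xu -mulgA -he subrr.
by rewrite /lann /= mulgBr xu => /subr0_eq hx; exists x.
Qed.

Lemma RP_exists a : exists q, RP a q.
Proof.
have [p hp] := LP_exists (star a); exists (star p).
by apply/LP_star; rewrite starK.
Qed.

Lemma LP_mul a b p q :
  lann b `<=` lann a -> LP a p -> LP b q -> LP a (p * q).
Proof.
move=> + [hp ap] [hq bq]; rewrite /LP /= ap bq => hqp.
(* This absorption gives (p q)(p q) = p (q p) q = p p q = p q. *)
have qp : q * p = p by exact: idempotent_mull.
split; first by rewrite /is_idempotent -mulgA (mulgA q) qp mulgA -hp.
apply/seteqP; split=> x; rewrite /lann /= mulgA => h; first by rewrite h mul0g.
(* If x p q = 0, then x p = x p p = x p (q p) = (x p q) p = 0. *)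
by rewrite hp -{2}qp !mulgA h mul0g.
Qed.

Lemma RP_mul a b p q :
  rann b `<=` rann a -> RP a p -> RP b q -> RP a (q * p).
Proof.
move=> hba /LP_star hp /LP_star hq; apply/LP_star; rewrite starM.
by apply: LP_mul hp hq; exact: subset_lann_star.
Qed.

Lemma plus_le_refl a : plus_le a a.
Proof.
have [p [hp ap]] := LP_exists a; have [q [hq aq]] := RP_exists a.
split=> //; exists q => //; exists p => //.
by rewrite (idempotent_mull hp) -?ap // (idempotent_mulr hq) -?aq.
Qed.

Lemma plus_le_trans b a c : plus_le a b -> plus_le b c -> plus_le a c.
Proof.
move=> [lba rba [q1 hq1 [p1 hp1 ea]]] [lcb rcb [q2 hq2 [p2 hp2 eb]]].
split; [exact: subset_trans lba | exact: subset_trans rba |].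
exists (q2 * q1); first exact: RP_mul hq1 hq2.
exists (p1 * p2); first exact: LP_mul hp1 hp2.
by rewrite ea eb !mulgA.
Qed.

(** The first relation supplies a = p b q; the annihilator inclusions of the second make p and q act
    as identities on b. *)
Lemma plus_le_antisym a b : plus_le a b -> plus_le b a -> a = b.
Proof.
move=> [_ _ [q [hq aq] [p [hp ap] ea]]] [lab rab _].
by rewrite ea (idempotent_mull hp) -?ap // (idempotent_mulr hq) -?aq.
Qed.

End StarRing.

Theorem theorem6p1 (R : starRingType) (hR : rickart R) :
  Relation_Definitions.order R (@plus_le R).
Proof.
split.
- exact: plus_le_refl.
- by move=> a b c; exact: plus_le_trans.
- by move=> a b; exact: plus_le_antisym.
Qed.
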